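(* Let $\mathcal S$ be a timestamped bipartite graph stream, $\gamma$ the resampling parameter, $M$ the reservoir size parameter, and $n_{\max}\gg M$ an upper bound on the number of edges within a window. Let $t$ be a query time and $W$ a window size given at query time, let $\xi_W^t$ be the number of butterflies in the window graph $G_W^t$, let $h^t$ be the maximum number of butterflies in $G^t$ (the graph formed by all edges received up to time $t$) that an edge can be part of, and let $Y_{\mathrm{tw}}^t$ be the estimate returned by algorithm FLEETTSW. Then $Y_{\mathrm{tw}}^t$ is an unbiased estimate of $\xi_W^t$, i.e. $\mathbb E[Y_{\mathrm{tw}}^t]=\xi_W^t$. Moreover, for $\epsilon,\delta\in(0,1)$, if $$M\in\Omega\left(\log_\gamma\frac{M}{n_{\max}}\cdot\sqrt[4]{\frac{n_{\max}^4\,h^t}{\epsilon^2\,\xi_W^t}\,\ln\frac{h^t}{\delta}}\right)$$ (where $\xi_W^t>0$), then $\Pr\left[\,|Y_{\mathrm{tw}}^t-\xi_W^t|\ge\epsilon\,\xi_W^t\,\right]\le\delta$.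
   Context: Graphs are simple, undirected bipartite graphs with vertex set $L\sqcup R$ and edges in $L\times R$. A butterfly is a subgraph on $a\ne b\in L$, $x\neq y\in R$ with all four edges $(a,x),(a,y),(b,x),(b,y)$ present. A timestamped graph stream is a sequence of distinct edges in arbitrary fixed order, each with a timestamp, read in order of timestamps. At query time $t$ with window size $W$, $G_W^t$ is the graph of all edges received so far with timestamps greater than $t-W$; it has at most $n_{\max}$ edges. For an edge set $\mathcal A$, $\xi(\mathcal A)$ is the number of butterflies in the graph induced by $\mathcal A$. Algorithm FLEETTSW (with a retention probability $0<\gamma<1$): let $T=\lceil 1+\log_\gamma\frac{M}{n_{\max}}\rceil$. Maintain $T$ reservoirs $\mathcal R_0,\mathcal R_1,\ldots,\mathcal R_{T-1}$, initially empty, each of capacity $M/T$, and numbers $d_\ell$, initially $0$ ($d_\ell$ is the timestamp of the edge most recently discarded from $\mathcal R_\ell$). Each arriving edge $e$ (with its timestamp) is inserted into $\mathcal R_0$; for $\ell\ge1$, if $e$ was inserted into $\mathcal R_{\ell-1}$, then with probability $\gamma$ (independent coins) it is also inserted into $\mathcal R_\ell$, and otherwise the processing of $e$ stops. Each $\mathcal R_\ell$ is a first-in-first-out queue: whenever $|\mathcal R_\ell|>M/T$ after an insertion, the edge of earliest timestamp is removed from $\mathcal R_\ell$ and $d_\ell$ is set to its timestamp. On a query at time $t$ with window size $W$: among the $T$ levels let $\ell_*$ be the smallest $\ell$ with $d_\ell\le t-W$ (i.e. the smallest level whose reservoir contains all edges of the window that were sampled to that level); let $\mathcal A$ be the set of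 edges in $\mathcal R_{\ell_*}$ with timestamp greater than $t-W$; return $Y_{\mathrm{tw}}^t=\gamma^{-4\ell_*}\,\xi(\mathcal A)$. Expectation and probability are over the algorithm's coin flips only.
   Formalization: If no level has d_ℓ ≤ t−W (ℓ_* undefined), Y is taken as the level T−1 estimate from all window edges sampled to that level, even discarded ones; n_max ≫ M is n_max ≥ K·M, K > 1 fixed; the Ω constant depends on γ, K and an upper bound δ_0 < 1 on δ. *)

(* Defs.v *)
From HB Require Import structures.
From mathcomp Require Import all_boot all_order all_algebra.
From mathcomp Require Import reals exp.

Set Implicit Arguments.
Unset Strict Implicit.
Unset Printing Implicit Defensive.

Import Order.TTheory GRing.Theory Num.Theory.
Local Open Scope ring_scope.

(* The butterfly on a != b, x != y is represented by ([set a; b], [set x; y]). *)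
Definition butterflies (L V : finType) (A : {set L * V}) :
    {set {set L} * {set V}} :=
  [set B : {set L} * {set V} | [&& #|B.1| == 2, #|B.2| == 2 & setX B.1 B.2 \subset A]].

Definition num_butterflies (L V : finType) (A : {set L * V}) : nat :=
  #|butterflies A|.

Definition max_butterflies_per_edge (L V : finType) (A : {set L * V}) : nat :=
  \max_(e in A) #|[set B in butterflies A | e \in setX B.1 B.2]|.

Notation timed_edge R L V := (prod (prod L V) R).

Definition graph_stream (R : realType) (L V : finType)
    (s : seq (timed_edge R L V)) : bool :=
  uniq (map fst s) && sorted <=%R (map snd s).

Definition edges_of (R : realType) (L V : finType)
    (s : seq (timed_edge R L V)) : {set L * V} :=
  [set:: map fst s].

Definition received (R : realType) (L V : finType)
    (s : seq (timed_edge R L V)) (t : R) : seq (timed_edge R L V) :=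
  [seq e <- s | e.2 <= t].

Definition recent (R : realType) (L V : finType) (t W : R)
    (s : seq (timed_edge R L V)) : seq (timed_edge R L V) :=
  [seq e <- s | t - W < e.2].

Definition window (R : realType) (L V : finType)
    (s : seq (timed_edge R L V)) (t W : R) : seq (timed_edge R L V) :=
  recent t W (received s t).

Definition logb (R : realType) (b x : R) : R := ln x / ln b.

(* The ceiling is an [int]; it is at least 2 as soon as 0 < b < 1 and
   0 < M < nmax, so the absolute value is then harmless. *)
Definition num_levels (R : realType) (g : R) (M nmax : nat) : nat :=
  `|Num.ceil (1 + logb g (M%:R / nmax%:R))|%N.

(* A reservoir is a queue (oldest edge first) together with the timestamp of
   the edge most recently discarded from it. *)
Notation reservoir R L V := (prod (seq (timed_edge R L V)) R).

(* Edges are enqueued in timestamp order, so the head is an earliest edge. *)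
Definition enqueue (R : realType) (L V : finType) (cap : R)
    (e : timed_edge R L V) (r : reservoir R L V) : reservoir R L V :=
  let q := rcons r.1 e in
  if cap < (size q)%:R then (behead q, (head e q).2) else (q, r.2).

(* [offer cap e c rs] inserts e into the first reservoir of rs and goes on with
   the next one as long as the coins in c show heads. *)
Fixpoint offer (R : realType) (L V : finType) (cap : R)
    (e : timed_edge R L V) (c : seq bool) (rs : seq (reservoir R L V)) :
    seq (reservoir R L V) :=
  match rs with
  | [::] => [::]
  | r :: rs' =>
    enqueue cap e r :: (if c is true :: c' then offer cap e c' rs' else rs')
  end.

(* The coins for m arrivals and T levels: w (i, k) decides whether the i-th
   arrival, once inserted at level k, is also inserted at level k + 1.  All
   the coins are tossed in advance; those which are never looked at do not
   affect the law of the output. *)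
Definition coins (m T : nat) : finType := {ffun 'I_m * 'I_T.-1 -> bool}.

Definition coins_of (m T : nat) (w : coins m T) (i : 'I_m) : seq bool :=
  [seq w (i, k) | k <- enum 'I_T.-1].

Definition coins_weight (R : realType) (g : R) (m T : nat) (w : coins m T) : R :=
  \prod_ik (if w ik then g else 1 - g).

Definition expectation (R : realType) (g : R) (m T : nat)
    (X : coins m T -> R) : R :=
  \sum_(w : coins m T) coins_weight g w * X w.

Definition proba (R : realType) (g : R) (m T : nat) (E : pred (coins m T)) : R :=
  \sum_(w : coins m T | E w) coins_weight g w.

Definition run (R : realType) (L V : finType) (M T : nat)
    (u : seq (timed_edge R L V)) (w : coins (size u) T) :
    seq (reservoir R L V) :=
  foldl (fun rs i =>
           offer (M%:R / T%:R) (tnth (in_tuple u) i) (coins_of w i) rs)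
        (nseq T ([::], 0)) (enum 'I_(size u)).

Definition level_estimate (R : realType) (L V : finType) (g : R) (l : nat)
    (A : {set L * V}) : R :=
  g ^- (4 * l) * (num_butterflies A)%:R.

(* The answer to the query (t, W); [None] when no level l < T has
   d_l <= t - W. *)
Definition answer (R : realType) (L V : finType) (g : R) (M T : nat) (t W : R)
    (u : seq (timed_edge R L V)) (w : coins (size u) T) : option R :=
  let rs := run M w in
  let l := find (fun r => r.2 <= t - W) rs in
  if (l < size rs)%N then
    Some (level_estimate g l (edges_of (recent t W (nth ([::], 0) rs l).1)))
  else None.

Definition top_sample (R : realType) (L V : finType) (T : nat)
    (u : seq (timed_edge R L V)) (w : coins (size u) T) :
    seq (timed_edge R L V) :=
  [seq tnth (in_tuple u) i | i <- enum 'I_(size u) & all id (coins_of w i)].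

(* The algorithm does not say what it returns when no level qualifies, an event
   of positive probability as soon as the window exceeds the capacity of a
   reservoir.  On that event only, the value is taken to be the level T - 1
   estimate over all the window edges sampled to that level, including those
   discarded since.  This is the natural completion for which the estimate is
   unbiased; one computed from the edges still stored, or a constant, is not. *)
Definition estimate (R : realType) (L V : finType) (g : R) (M T : nat) (t W : R)
    (u : seq (timed_edge R L V)) (w : coins (size u) T) : R :=
  if answer g M t W w is Some y then y
  else level_estimate g T.-1 (edges_of (recent t W (top_sample w))).

(* Main.v *)
Require Import Defs.
From HB Require Import structures.
From mathcomp Require Import all_boot all_order all_algebra.
From mathcomp Require Import reals sequences exp.
From mathcomp Require Import ring lra.

Set Implicit Arguments.
Unset Strict Implicit.
Unset Printing Implicit Defensive.

Import Order.TTheory GRing.Theory Num.Theory.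
Local Open Scope ring_scope.

(* The number of butterflies sampled to level l, divided by g^(4l), is a
   martingale in l, and the level that answers the query is a stopping time for
   it, which gives unbiasedness.

   For the tail bound, no control of the reservoir sizes is needed: the answer
   comes from some level l < T, and with high probability all these levels are
   simultaneously accurate.
   At a level, a butterfly shares an edge with fewer than 4h others, so the
   butterflies get 4h colours with edge-disjoint colour classes; inside a class
   the sampling events are independent, and Chernoff's argument bounds the
   failure probability by 2 exp(-eps^2 xi g^(4l) / (32h)).  Since
   g^(T-1) >= g M / nmax, the hypothesis on M makes the exponent at the top level
   at least a large multiple of ln(h / delta); below the top level the exponents
   grow geometrically, so the union bound over the levels costs a constant. *)

(** * Independent coins *)

Definition bernoulli_weight (R : realType) (g : R) (I : finType)
    (w : {ffun I -> bool}) : R :=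
  \prod_i (if w i then g else 1 - g).

Definition bernoulli_mean (R : realType) (g : R) (I : finType)
    (F : {ffun I -> bool} -> R) : R :=
  \sum_w bernoulli_weight g w * F w.

Definition heads (I : finType) (D : {set I}) (w : {ffun I -> bool}) : bool :=
  [forall i in D, w i].

Lemma eq_heads (I : finType) (D : {set I}) (w w' : {ffun I -> bool}) :
  {in D, w =1 w'} -> heads D w = heads D w'.
Proof.
by move=> ww'; apply: eq_forallb => i; case: (boolP (i \in D)) => //= /ww' ->.
Qed.

(** Independence in functional form: [F] never reads the coins in [D]. *)
Definition independent_of (R : Type) (I : finType) (D : {set I})
    (F : {ffun I -> bool} -> R) : Prop :=
  forall w w' : {ffun I -> bool}, {in ~: D, w =1 w'} -> F w = F w'.

Lemma bernoulli_weight_ge0 (R : realType) (g : R) (I : finType)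
    (w : {ffun I -> bool}) : 0 <= g <= 1 -> 0 <= bernoulli_weight g w.
Proof.
move=> /andP[g0 g1]; apply: prodr_ge0 => i _.
by case: ifP => // _; rewrite subr_ge0.
Qed.

Lemma bernoulli_mean_sum (R : realType) (g : R) (I : finType) (J : Type)
    (r : seq J) (P : pred J) (F : J -> {ffun I -> bool} -> R) :
  bernoulli_mean g (fun w => \sum_(j <- r | P j) F j w)
  = \sum_(j <- r | P j) bernoulli_mean g (F j).
Proof.
rewrite /bernoulli_mean exchange_big /=.
by apply: eq_bigr => w _; rewrite mulr_sumr.
Qed.

Lemma bernoulli_meanZ (R : realType) (g : R) (I : finType) (c : R)
    (F : {ffun I -> bool} -> R) :
  bernoulli_mean g (fun w => c * F w) = c * bernoulli_mean g F.
Proof. by rewrite mulr_sumr; apply: eq_bigr => w _; rewrite mulrCA. Qed.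

Lemma eq_bernoulli_mean (R : realType) (g : R) (I : finType)
    (F G : {ffun I -> bool} -> R) :
  F =1 G -> bernoulli_mean g F = bernoulli_mean g G.
Proof. by move=> FG; apply: eq_bigr => w _; rewrite FG. Qed.

Lemma ler_bernoulli_mean (R : realType) (g : R) (I : finType)
    (F G : {ffun I -> bool} -> R) :
  0 <= g <= 1 -> (forall w, F w <= G w) ->
  bernoulli_mean g F <= bernoulli_mean g G.
Proof.
by move=> g01 FG; apply: ler_sum => w _; rewrite ler_wpM2l ?bernoulli_weight_ge0.
Qed.

Lemma bernoulli_mean1 (R : realType) (g : R) (I : finType) :
  @bernoulli_mean R g I (fun=> 1) = 1.
Proof.
rewrite /bernoulli_mean; under eq_bigr do rewrite mulr1.
rewrite /bernoulli_weight.
rewrite -(bigA_distr_bigA (fun (_ : I) (b : bool) => if b then g else 1 - g)) /=.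
by apply: big1 => i _; rewrite big_bool /= subrKC.
Qed.

(** Flipping coin [a] pairs the assignments with [w a] true and false; both share the value of [F]
    and the weight of the other coins, and [g] and [1 - g] add up to 1. *)
Lemma bernoulli_mean_coin (R : realType) (g : R) (I : finType) (a : I)
    (F : {ffun I -> bool} -> R) :
  independent_of [set a] F ->
  bernoulli_mean g (fun w => (w a)%:R * F w) = g * bernoulli_mean g F.
Proof.
move=> Fa.
pose flip (w : {ffun I -> bool}) : {ffun I -> bool} :=
  [ffun i => if i == a then ~~ w i else w i].
have flipK : involutive flip.
  by move=> w; apply/ffunP=> i; rewrite !ffunE; case: (i == a); rewrite ?negbK.
have Fflip w : F (flip w) = F w.
  by apply: Fa => i; rewrite !inE ffunE => /negbTE ->.
pose rest (w : {ffun I -> bool}) := \prod_(i | i != a) (if w i then g else 1 - g).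
have rest_flip w : rest (flip w) = rest w.
  by apply: eq_bigr => i /negbTE ia; rewrite ffunE ia.
have weightE w : bernoulli_weight g w = (if w a then g else 1 - g) * rest w.
  by rewrite /bernoulli_weight (bigD1 a).
have headsE : bernoulli_mean g (fun w => (w a)%:R * F w)
    = \sum_(w : {ffun I -> bool} | w a) g * (rest w * F w).
  rewrite /bernoulli_mean [RHS]big_mkcond /=.
  apply: eq_bigr => w _; rewrite weightE; case: (w a).
    by rewrite mul1r mulrA.
  by rewrite mul0r mulr0.
rewrite headsE -mulr_sumr; congr (_ * _).
rewrite /bernoulli_mean; apply/esym.
rewrite (bigID (fun w : {ffun I -> bool} => w a)) /= addrC.
rewrite (reindex_inj (inv_inj flipK)) /=.
rewrite (eq_bigl (fun w : {ffun I -> bool} => w a)); last first.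
  by move=> w; rewrite ffunE eqxx negbK.
rewrite -big_split /=; apply: eq_bigr => w wa.
rewrite !weightE ffunE eqxx wa /= rest_flip Fflip; ring.
Qed.

(** The coins of [D] are peeled off one at a time: the indicator of the remaining ones, times [F],
    does not read the coin removed. *)
Lemma bernoulli_mean_heads (R : realType) (g : R) (I : finType) (D : {set I})
    (F : {ffun I -> bool} -> R) :
  independent_of D F ->
  bernoulli_mean g (fun w => (heads D w)%:R * F w)
  = g ^+ #|D| * bernoulli_mean g F.
Proof.
have [m] := ubnP #|D|; elim: m D => // m IH D Dm FD.
case: (set_0Vmem D) => [->|[a aD]].
  rewrite cards0 expr0 mul1r; apply: eq_bernoulli_mean => w.
  rewrite (_ : heads set0 w) ?mul1r //.
  by apply/forall_inP => i; rewrite inE.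
have headsD w : heads D w = w a && heads (D :\ a) w.
  apply/forall_inP/andP => [Dw|[wa /forall_inP Dw] i iD].
    split; first exact: Dw.
    by apply/forall_inP => i; rewrite in_setD1 => /andP[_]; apply: Dw.
  by have [->//|ia] := eqVneq i a; apply: Dw; rewrite in_setD1 ia.
rewrite (@eq_bernoulli_mean _ _ _ _
  (fun w => (w a)%:R * ((heads (D :\ a) w)%:R * F w))); last first.
  by move=> w; rewrite headsD -mulnb natrM mulrA.
rewrite bernoulli_mean_coin; last first.
  move=> w w' ww'; congr ((nat_of_bool _)%:R * _).
    by apply: eq_heads => i; rewrite in_setD1 => /andP[ia _]; rewrite ww' // !inE.
  by apply: FD => i; rewrite !inE => iD; apply: ww'; rewrite !inE; apply: contraNneq iD => ->.
rewrite IH.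
- by rewrite (cardsD1 a D) aD add1n exprS mulrA.
- by move: Dm; rewrite (cardsD1 a D) aD.
- move=> w w' ww'; apply: FD => i iD; apply: ww'; rewrite !inE negb_and negbK.
  by move: iD; rewrite inE => ->; rewrite orbT.
Qed.

(** With [c = expR th - 1] each factor is [expR (th * heads)], so this is the exact moment
    generating function of the number of blocks [D j] showing only heads; disjoint blocks are
    independent. *)
Lemma bernoulli_mean_prod_heads (R : realType) (g c : R) (I J : finType)
    (D : J -> {set I}) (n : nat) (S : {set J}) :
  {in S, forall j, #|D j| = n} ->
  {in S &, forall j k, j != k -> [disjoint D j & D k]} ->
  bernoulli_mean g (fun w => \prod_(j in S) (1 + c * (heads (D j) w)%:R))
  = (1 + c * g ^+ n) ^+ #|S|.
Proof.
have [m] := ubnP #|S|; elim: m S => // m IH S Sm Dn Ddisj.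
case: (set_0Vmem S) => [->|[a aS]].
  rewrite cards0 expr0 -[RHS](@bernoulli_mean1 R g I).
  by apply: eq_bernoulli_mean => w; rewrite big_set0.
pose G w := \prod_(j in S :\ a) (1 + c * (heads (D j) w)%:R) : R.
have SD1 : {subset S :\ a <= S} by move=> i; rewrite in_setD1 => /andP[].
have Ga : independent_of (D a) G.
  move=> w w' ww'; apply: eq_bigr => j; rewrite in_setD1 => /andP[ja jS].
  congr (1 + c * (nat_of_bool _)%:R); apply: eq_heads => i iD; apply: ww'.
  by rewrite inE (disjointFr (Ddisj j a jS aS ja) iD).
rewrite (@eq_bernoulli_mean _ _ _ _
   (fun w => \sum_(b : bool) if b then G w else c * ((heads (D a) w)%:R * G w))); last first.
  move=> w; rewrite big_bool /= (big_setD1 a aS) /= -/(G w); ring.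
rewrite bernoulli_mean_sum big_bool /= bernoulli_meanZ bernoulli_mean_heads //.
rewrite IH.
- rewrite (cardsD1 a S) aS add1n exprS Dn //; ring.
- by move: Sm; rewrite (cardsD1 a S) aS.
- by move=> j /SD1; apply: Dn.
- by move=> j k /SD1 jS /SD1 kS; apply: Ddisj.
Qed.

(** * Concentration under bounded dependence *)

(** Jensen's inequality, from the tangent of [expR] at the mean [m]: the deviations [y c - m] sum to
    0. *)
Lemma expR_mean_le (R : realType) (k : nat) (y : 'I_k -> R) : (0 < k)%N ->
  expR ((\sum_c y c) / k%:R) <= (\sum_c expR (y c)) / k%:R.
Proof.
move=> k0; set m := (\sum_c y c) / k%:R.
have k0' : 0 < k%:R :> R by rewrite ltr0n.
rewrite ler_pdivlMr // mulrC.
have -> : k%:R * expR m = \sum_(c < k) expR m * (1 + (y c - m)).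
  rewrite -mulr_sumr big_split /= sumrB !sumr_const card_ord -[m *+ k]mulr_natr.
  rewrite /m divfK ?gt_eqF // subrr addr0; ring.
apply: ler_sum => c _.
rewrite -[y c in leRHS](subrKC m) expRD ler_wpM2l ?expR_ge0 //.
exact: expR_ge1Dx.
Qed.

(** [expR (- x) >= 1 - x] gives [(1 - x) * expR x <= 1], and [1 <= (1 - x) * (1 + x + 2 * x ^+ 2)]
    in the given range. *)
Lemma expR_le_quadratic (R : realType) (x : R) : x <= 1 / 2 ->
  expR x <= 1 + x + 2 * x ^+ 2.
Proof.
move=> x2.
have := expR_ge1Dx (- x); rewrite expRN => H.
have e0 := expR_gt0 x.
have : (1 - x) * expR x <= 1 by rewrite -ler_pdivlMr // mul1r.
move=> H2.
have : (1 - x) * expR x <= (1 - x) * (1 + x + 2 * x ^+ 2).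
  apply: le_trans H2 _.
  have -> : (1 - x) * (1 + x + 2 * x ^+ 2) = 1 + x ^+ 2 * (1 - 2 * x) by ring.
  rewrite lerDl mulr_ge0 ?sqr_ge0 //; lra.
by rewrite ler_pM2l //; lra.
Qed.

(* The colour classes are combined by Jensen's inequality for [expR], so they
   need not have comparable sizes. *)
Lemma coloured_mgf (R : realType) (g th : R) (I J : finType)
    (D : J -> {set I}) (n k : nat) (S : {set J}) (f : J -> 'I_k) :
  0 <= g <= 1 -> (0 < k)%N ->
  {in S, forall j, #|D j| = n} ->
  {in S &, forall i j, i != j -> f i = f j -> [disjoint D i & D j]} ->
  bernoulli_mean g (fun w => expR ((th * (\sum_(j in S) (heads (D j) w)%:R)
      - #|S|%:R * g ^+ n * (expR th - 1)) / k%:R)) <= 1.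
Proof.
move=> g01 k0 Dn Ddisj; set q := g ^+ n; set c := expR th - 1.
have k0' : 0 < k%:R :> R by rewrite ltr0n.
pose Sc (i : 'I_k) := [set j in S | f j == i].
pose y i w := th * (\sum_(j in Sc i) (heads (D j) w)%:R) - #|Sc i|%:R * q * c : R.
have part (F : J -> R) : \sum_(j in S) F j = \sum_i \sum_(j in Sc i) F j.
  rewrite (partition_big f xpredT) //=; apply: eq_bigr => i _.
  by apply: eq_bigl => j; rewrite inE.
have yE w : th * (\sum_(j in S) (heads (D j) w)%:R) - #|S|%:R * q * c
    = \sum_i y i w.
  rewrite sumrB -mulr_sumr -part -!mulr_suml; congr (_ - _ * _ * _).
  rewrite -sum1_card natr_sum part; apply: eq_bigr => i _.
  by rewrite -sum1_card natr_sum.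
apply: (@le_trans _ _ (bernoulli_mean g (fun w => k%:R^-1 * \sum_i expR (y i w)))).
  by apply: ler_bernoulli_mean => // w; rewrite yE [leRHS]mulrC; apply: expR_mean_le.
rewrite bernoulli_meanZ bernoulli_mean_sum ler_pdivrMl // mulr1.
rewrite -[leRHS](_ : \sum_(i < k) 1 = _); last by rewrite sumr_const card_ord.
apply: ler_sum => i _.
rewrite (@eq_bernoulli_mean _ _ _ _ (fun w => expR (- (#|Sc i|%:R * q * c)) *
    \prod_(j in Sc i) (1 + c * (heads (D j) w)%:R))); last first.
  move=> w; rewrite /y addrC expRD mulr_sumr expR_sum; congr (_ * _).
  apply: eq_bigr => j _; case: heads; rewrite ?mulr1 ?mulr0 ?expR0 ?addr0 //.
  by rewrite /c subrKC.
have ScS : {subset Sc i <= S} by move=> j; rewrite inE => /andP[].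
rewrite bernoulli_meanZ (@bernoulli_mean_prod_heads _ _ _ _ _ _ n); first last.
- move=> j l; rewrite !inE => /andP[jS /eqP fj] /andP[lS /eqP fl] jl.
  by apply: Ddisj => //; rewrite fj fl.
- by move=> j /ScS; apply: Dn.
(* The comparison is [1 + y <= expR y] raised to a power; the base [1 + c * q] is nonnegative
   because [c > -1] and [0 <= q <= 1]. *)
rewrite expRN ler_pdivrMl ?expR_gt0 // mulr1 -mulrA expRM_natl.
rewrite lerXn2r ?nnegrE ?expR_ge0 //; last by rewrite [q * c]mulrC expR_ge1Dx.
have q1 : 0 <= q <= 1.
  by case/andP: g01 => g0 g1; rewrite exprn_ge0 //= exprn_ile1.
have : 0 < expR th := expR_gt0 th.
rewrite /c -/q; case/andP: q1 => *; nra.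
Qed.

Lemma markov_bernoulli (R : realType) (g : R) (I : finType)
    (F : {ffun I -> bool} -> R) (E : pred {ffun I -> bool}) :
  0 <= g <= 1 -> (forall w, 0 <= F w) -> (forall w, E w -> 1 <= F w) ->
  \sum_(w | E w) bernoulli_weight g w <= bernoulli_mean g F.
Proof.
move=> g01 F0 FE; rewrite big_mkcond; apply: ler_sum => w _.
have W := bernoulli_weight_ge0 w g01.
by case: ifP => [/FE F1|_]; [rewrite ler_peMr | rewrite mulr_ge0].
Qed.

(** Exponential Markov inequality on [coloured_mgf], both tails together; the [k] colours cost a
    factor [k] in the exponent. *)
Lemma coloured_chernoff (R : realType) (g eps : R) (I J : finType)
    (D : J -> {set I}) (n k : nat) (S : {set J}) (f : J -> 'I_k) :
  0 <= g <= 1 -> (0 < k)%N -> 0 < eps < 1 ->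
  {in S, forall j, #|D j| = n} ->
  {in S &, forall i j, i != j -> f i = f j -> [disjoint D i & D j]} ->
  \sum_(w | eps * (#|S|%:R * g ^+ n)
            <= `|\sum_(j in S) (heads (D j) w)%:R - #|S|%:R * g ^+ n|)
     bernoulli_weight g w
  <= 2 * expR (- (eps ^+ 2 * (#|S|%:R * g ^+ n) / (8 * k%:R))).
Proof.
move=> g01 k0 /andP[eps0 eps1] Dn Ddisj; set mu := #|S|%:R * g ^+ n.
have k0' : 0 < k%:R :> R by rewrite ltr0n.
have mu0 : 0 <= mu by case/andP: g01 => *; rewrite mulr_ge0 // exprn_ge0.
pose X w := \sum_(j in S) (heads (D j) w)%:R : R.
pose B := expR (- (eps ^+ 2 * mu / (8 * k%:R))).
pose Z th w := expR ((th * X w - mu * (expR th - 1)) / k%:R).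
have Zmean th : bernoulli_mean g (Z th) <= 1 by exact: (coloured_mgf th g01 k0 Dn Ddisj).
(* One term per tail. At [th = eps / 4] or [- (eps / 4)] the deviation contributes at least
   [eps ^+ 2 * mu / 4] and the quadratic error is [2 * th ^+ 2 * mu = eps ^+ 2 * mu / 8], so on the
   bad event one term reaches 1. *)
pose F w := \sum_(b : bool) B * Z (if b then eps / 4 else - (eps / 4)) w.
apply: (@le_trans _ _ (bernoulli_mean g F)); last first.
  rewrite bernoulli_mean_sum big_bool /= !bernoulli_meanZ.
  rewrite -mulrDr mulrC ler_wpM2r ?expR_ge0 //.
  by have := lerD (Zmean (eps / 4)) (Zmean (- (eps / 4))); lra.
apply: markov_bernoulli => // w; rewrite /F big_bool /=.
  by rewrite addr_ge0 // mulr_ge0 ?expR_ge0.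
have key th : th <= 1 / 2 -> eps ^+ 2 * mu / 8 <= th * X w - mu * (th + 2 * th ^+ 2) ->
    1 <= B * Z th w.
  move=> th2 H; rewrite -expRD -[leLHS]expR0 ler_expR.
  have -> : - (eps ^+ 2 * mu / (8 * k%:R)) + (th * X w - mu * (expR th - 1)) / k%:R
      = (th * X w - mu * (expR th - 1) - eps ^+ 2 * mu / 8) / k%:R.
    by field; rewrite gt_eqF.
  rewrite divr_ge0 ?(ltW k0') // subr_ge0.
  apply: le_trans H _; rewrite lerD2l lerN2 ler_wpM2l //.
  have := expR_le_quadratic th2; lra.
rewrite ler_normr -/(X w) => /orP[] H.
  have K : 1 <= B * Z (eps / 4) w by apply: key; [lra | nra].
  by apply: le_trans K _; rewrite lerDl mulr_ge0 ?expR_ge0.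
have K : 1 <= B * Z (- (eps / 4)) w by apply: key; [lra | nra].
by apply: le_trans K _; rewrite lerDr mulr_ge0 ?expR_ge0.
Qed.

(** Colour all vertices but one recursively; the fewer than [k] neighbours of the last one leave it
    a free colour. *)
Lemma greedy_colouring (J : finType) (r : rel J) (k : nat) (S : {set J}) :
  symmetric r -> (0 < k)%N ->
  {in S, forall j, (#|[set i in S | (i != j) && r i j]| < k)%N} ->
  exists f : J -> 'I_k, {in S &, forall i j, i != j -> r i j -> f i != f j}.
Proof.
move=> rsym k0; have [m] := ubnP #|S|; elim: m S => // m IH S Sm deg.
case: (set_0Vmem S) => [->|[a aS]].
  by exists (fun=> Ordinal k0) => i j; rewrite inE.
have SD1 : {subset S :\ a <= S} by move=> i; rewrite in_setD1 => /andP[].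
case: (IH (S :\ a)) => [| j /SD1 jS | f fP].
- by move: Sm; rewrite (cardsD1 a S) aS.
- apply: leq_ltn_trans (deg j jS); apply: subset_leq_card.
  by apply/subsetP => i; rewrite !inE => /andP[/andP[_ ->]].
pose N := [set i in S | (i != a) && r i a].
have [c cN] : exists c, c \notin f @: N.
  apply/existsP; rewrite -negb_forall; apply/forallP => allN.
  have := deg a aS; rewrite ltnNge => /negP; apply.
  apply: leq_trans (leq_imset_card f N).
  rewrite -[leqLHS]card_ord; apply: subset_leq_card; apply/subsetP => i _; exact: allN.
exists (fun j => if j == a then c else f j) => i j iS jS ij rij.
have [ia|ia] := eqVneq i a; have [ja|ja] := eqVneq j a.
- by rewrite ia ja eqxx in ij.
- apply: contraNneq cN => ->; apply: imset_f.
  by rewrite inE jS ja rsym -ia rij.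
- apply: contraNneq cN => <-; apply: imset_f.
  by rewrite inE iS ia -ja rij.
- by apply: fP => //; rewrite in_setD1 ?ia ?ja.
Qed.

(** * Butterflies *)

Lemma card_butterfly (L V : finType) (A : {set L * V}) (B : {set L} * {set V}) :
  B \in butterflies A -> #|setX B.1 B.2| = 4%N.
Proof. by rewrite inE cardsX => /and3P[/eqP -> /eqP ->]. Qed.

Lemma butterfly_sub (L V : finType) (A : {set L * V}) (B : {set L} * {set V}) :
  B \in butterflies A -> setX B.1 B.2 \subset A.
Proof. by rewrite inE => /and3P[]. Qed.

Lemma butterflies_restrict (L V : finType) (A A' : {set L * V}) :
  A' \subset A ->
  butterflies A' = [set B in butterflies A | setX B.1 B.2 \subset A'].
Proof.
move=> AA'; apply/setP => B; rewrite !inE -!andbA; do 2 congr (_ && _).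
by apply/idP/andP => [BA'|[]//]; split=> //; apply: subset_trans AA'.
Qed.

(** Each of the four edges of [B] lies in at most [max_butterflies_per_edge G] butterflies; counting
    [B] itself among those that meet it makes the inequality strict. *)
Lemma butterfly_degree (L V : finType) (G A : {set L * V})
    (B : {set L} * {set V}) :
  A \subset G -> B \in butterflies A ->
  (#|[set B' in butterflies A |
       (B' != B) && ~~ [disjoint setX B'.1 B'.2 & setX B.1 B.2]]|
   < 4 * max_butterflies_per_edge G)%N.
Proof.
move=> AG BA; set N := [set B' in _ | _].
have BN : B \notin N by rewrite !inE eqxx /= andbF.
have <- : #|B |: N| = #|N|.+1 by rewrite cardsU1 BN.
pose through (e : L * V) := [set B' in butterflies G | e \in setX B'.1 B'.2].
have sub : B |: N \subset \bigcup_(e in setX B.1 B.2) through e.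
  apply/subsetP => B' B'N.
  have [e eB eB'] : exists2 e, e \in setX B.1 B.2 & e \in setX B'.1 B'.2.
    move: B'N; rewrite in_setU1 => /orP[/eqP ->|].
      have /card_gt0P[e eB] : (0 < #|setX B.1 B.2|)%N by rewrite (card_butterfly BA).
      by exists e.
    by rewrite inE => /and3P[_ _] /pred0Pn[e /andP[eB' eB]]; exists e.
  apply/bigcupP; exists e => //; rewrite inE eB' andbT.
  have B'A : B' \in butterflies A.
    by move: B'N; rewrite in_setU1 => /orP[/eqP -> //|]; rewrite inE => /andP[].
  by move: B'A; rewrite (butterflies_restrict AG) inE => /andP[].
apply: leq_trans (subset_leq_card sub) _.
apply: (@leq_trans (\sum_(e in setX B.1 B.2) #|through e|)).
  elim/big_rec2: _ => [|e k U _ IH]; first by rewrite cards0.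
  by apply: leq_trans (leq_card_setU _ _) _; rewrite leq_add2l.
rewrite -(card_butterfly BA) -sum_nat_const; apply: leq_sum => e eB.
apply: (@bigop.bigmax_sup _ e) => //.
by apply: (subsetP AG); apply: (subsetP (butterfly_sub BA)).
Qed.

(** * Samples and reservoirs *)

(** Coins are indexed by positions in the stream, so edge sets are translated into position sets. *)
Definition arrivals (R : realType) (L V : finType) (u : seq (timed_edge R L V))
    (E : {set L * V}) : {set 'I_(size u)} :=
  [set i | (tnth (in_tuple u) i).1 \in E].

Lemma arrival_inj (R : realType) (L V : finType) (u : seq (timed_edge R L V)) :
  uniq (map fst u) -> injective (fun i => (tnth (in_tuple u) i).1).
Proof.
case: u => [|x u] Uu; first by case.
move=> i j; rewrite !(tnth_nth x) /= -!(nth_map x x.1 fst) // => /eqP.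
rewrite (nth_uniq x.1) ?size_map // => /eqP; exact: val_inj.
Qed.

Lemma card_arrivals (R : realType) (L V : finType) (u : seq (timed_edge R L V))
    (E : {set L * V}) :
  uniq (map fst u) -> E \subset edges_of u -> #|arrivals u E| = #|E|.
Proof.
move=> Uu EU; rewrite -(card_imset _ (arrival_inj Uu)); congr #|pred_of_set _|.
apply/setP => e; apply/imsetP/idP => [[i] |eE]; first by rewrite inE => iE ->.
have := subsetP EU e eE; rewrite inE => /mapP[x /(tnthP (in_tuple u))[i xi] ex].
by exists i; rewrite ?inE -xi -?ex.
Qed.

Lemma disjoint_arrivals (R : realType) (L V : finType)
    (u : seq (timed_edge R L V)) (E F : {set L * V}) :
  [disjoint E & F] -> [disjoint arrivals u E & arrivals u F].
Proof.
move=> EF; apply/pred0P => i /=; rewrite !inE.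
by apply/negP => /andP[iE]; rewrite (disjointFr EF iE).
Qed.

(** What level [l] would hold with unlimited capacity. *)
Definition sample (R : realType) (L V : finType) (T : nat)
    (u : seq (timed_edge R L V)) (l : nat) (w : coins (size u) T) :
    seq (timed_edge R L V) :=
  [seq tnth (in_tuple u) i | i <- enum 'I_(size u) & all id (take l (coins_of w i))].

(** Coin [k] takes an edge from level [k] to [k + 1], so reaching level [l] is decided by the coins
    below [l]. *)
Definition coins_up_to (m T : nat) (l : nat) (S : {set 'I_m}) :
    {set 'I_m * 'I_T.-1} :=
  setX S [set k : 'I_T.-1 | (k < l)%N].

Lemma card_coins_up_to (m T l : nat) (S : {set 'I_m}) :
  (l <= T.-1)%N -> #|coins_up_to T l S| = (#|S| * l)%N.
Proof.
move=> lT; rewrite cardsX; congr (_ * _)%N.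
rewrite cardsE -sum1_card -(big_ord_widen_cond _ xpredT (fun=> 1%N)) //.
by rewrite sum1_card card_ord.
Qed.

Lemma size_coins_of (m T : nat) (w : coins m T) (i : 'I_m) :
  size (coins_of w i) = T.-1.
Proof. by rewrite size_map size_enum_ord. Qed.

Lemma all_take_coins (m T l : nat) (w : coins m T) (i : 'I_m) :
  all id (take l (coins_of w i)) = [forall k : 'I_T.-1, (k < l)%N ==> w (i, k)].
Proof.
rewrite -map_take all_map; apply/allP/forallP => [H k|H k].
  apply/implyP => kl; apply: H => /=.
  rewrite -(mem_map val_inj) map_take val_enum_ord take_iota mem_iota /= add0n.
  by rewrite leq_min kl ltn_ord.
rewrite -(mem_map val_inj) map_take val_enum_ord take_iota mem_iota /= add0n.
by rewrite leq_min => /andP[kl _]; apply: (implyP (H k)).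
Qed.

Lemma eq_sample (R : realType) (L V : finType) (T : nat)
    (u : seq (timed_edge R L V)) (l : nat) (w w' : coins (size u) T) :
  {in coins_up_to T l [set: 'I_(size u)], w =1 w'} -> sample l w = sample l w'.
Proof.
move=> ww'; congr map; apply: eq_filter => i; rewrite !all_take_coins.
apply: eq_forallb => k; case: ltnP => //= kl.
by apply: ww'; rewrite in_setX in_setT inE.
Qed.

Lemma mem_sample (R : realType) (L V : finType) (T : nat)
    (u : seq (timed_edge R L V)) (l : nat) (w : coins (size u) T) x :
  reflect (exists2 i : 'I_(size u), x = tnth (in_tuple u) i &
             forall k : 'I_T.-1, (k < l)%N -> w (i, k))
    (x \in sample l w).
Proof.
apply: (iffP mapP) => -[i].
  rewrite mem_filter all_take_coins => /andP[/forallP H _] ->.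
  by exists i => // k; apply: (implyP (H k)).
move=> -> H; exists i => //; rewrite mem_filter mem_enum inE andbT all_take_coins.
by apply/forallP => k; apply/implyP/H.
Qed.

(** Edges of the stream are distinct, so each has one arrival position, whose coins alone decide its
    presence at level [l]. *)
Lemma sub_recent_sample (R : realType) (L V : finType) (T : nat)
    (u : seq (timed_edge R L V)) (t W : R) (l : nat) (w : coins (size u) T)
    (E : {set L * V}) :
  uniq (map fst u) -> E \subset edges_of (recent t W u) ->
  (E \subset edges_of (recent t W (sample l w)))
  = heads (coins_up_to T l (arrivals u E)) w.
Proof.
move=> Uu EU; apply/subsetP/forall_inP => [H [i k]|H e eE].
  rewrite in_setX !inE /= => /andP[iE kl].
  have := H _ iE; rewrite inE => /mapP[x].
  rewrite mem_filter => /andP[_ /mem_sample[j -> wj]] /(arrival_inj Uu) ->.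
  exact: wj.
have := subsetP EU e eE; rewrite !inE => /mapP[x].
rewrite mem_filter => /andP[xt /(tnthP (in_tuple u))[i xi]] ex; apply/mapP; exists x => //.
rewrite mem_filter xt; apply/mem_sample; exists i => // k kl.
by apply: H; rewrite in_setX !inE /= -xi -ex eE.
Qed.

Lemma num_butterflies_sample (R : realType) (L V : finType) (T : nat)
    (u : seq (timed_edge R L V)) (t W : R) (l : nat) (w : coins (size u) T) :
  uniq (map fst u) ->
  (num_butterflies (edges_of (recent t W (sample l w))))%:R
  = \sum_(B in butterflies (edges_of (recent t W u)))
      (heads (coins_up_to T l (arrivals u (setX B.1 B.2))) w)%:R :> R.
Proof.
move=> Uu; rewrite /num_butterflies.
have sub : edges_of (recent t W (sample l w)) \subset edges_of (recent t W u).
  apply/subsetP => e; rewrite !inE => /mapP[x].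
  rewrite mem_filter => /andP[xt /mem_sample[i xi _]] ex.
  by apply/mapP; exists x; rewrite // mem_filter xt xi mem_tnth.
rewrite (butterflies_restrict sub) -sum1dep_card natr_sum big_mkcondr /=.
apply: eq_bigr => B Bu.
by rewrite (sub_recent_sample _ _ Uu (butterfly_sub Bu)); case: heads.
Qed.

(** * Contents of the bounded queues *)

Lemma nth_offer (R : realType) (L V : finType) (cap : R) (e : timed_edge R L V)
    (r0 : reservoir R L V) (rs : seq (reservoir R L V)) (l : nat) (c : seq bool) :
  (l < size rs)%N -> (l <= size c)%N ->
  nth r0 (offer cap e c rs) l
  = if all id (take l c) then enqueue cap e (nth r0 rs l) else nth r0 rs l.
Proof.
elim: rs l c => // r rs IH [|l] [|[] c] //= lr lc; exact: IH.
Qed.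

Lemma size_offer (R : realType) (L V : finType) (cap : R) (e : timed_edge R L V)
    (rs : seq (reservoir R L V)) (c : seq bool) :
  size (offer cap e c rs) = size rs.
Proof. by elim: rs c => [|r rs IH] [|[] c] //=; rewrite IH. Qed.

Lemma size_run (R : realType) (L V : finType) (M T : nat)
    (u : seq (timed_edge R L V)) (w : coins (size u) T) :
  size (run M w) = T.
Proof.
rewrite /run -[RHS](size_nseq T (([::], 0) : reservoir R L V)).
by elim: (enum _) (nseq _ _) => //= i r IH rs; rewrite IH size_offer.
Qed.

Definition fill (R : realType) (L V : finType) (cap : R)
    (q : seq (timed_edge R L V)) : reservoir R L V :=
  foldl (fun r e => enqueue cap e r) ([::], 0) q.

(** What a level has discarded never affects another level, so each queue can be replayed alone on
    its own sample. *)
Lemma nth_run (R : realType) (L V : finType) (M T : nat)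
    (u : seq (timed_edge R L V)) (w : coins (size u) T) (l : nat) :
  (l < T)%N ->
  nth ([::], 0) (run M w) l = fill (M%:R / T%:R) (sample l w).
Proof.
move=> lT; rewrite /fill.
have {2}<- : nth ([::], 0) (nseq T (([::], 0) : reservoir R L V)) l = ([::], 0).
  by rewrite nth_nseq lT.
rewrite /run /sample; have := size_nseq T (([::], 0) : reservoir R L V).
elim: (enum _) (nseq _ _) => //= i r IH rs rsT.
rewrite IH ?size_offer // nth_offer ?rsT //; last first.
  by rewrite size_coins_of -ltnS (ltn_predK lT).
by case: ifP.
Qed.

(** First in, first out on sorted arrivals: [n] counts the discarded edges, always a prefix, and the
    last one discarded bounds their timestamps. For [n = 0] the bound is vacuous, so the initial
    timestamp 0 is harmless. *)
Lemma fill_drop (R : realType) (L V : finType) (cap : R)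
    (q : seq (timed_edge R L V)) :
  sorted <=%R (map snd q) ->
  exists n, [/\ (n <= size q)%N, (fill cap q).1 = drop n q &
                {in take n q, forall e, e.2 <= (fill cap q).2}].
Proof.
elim/last_ind: q => [|q e IH]; first by exists 0%N.
rewrite map_rcons => qs.
have [] := IH; first by move: qs; rewrite -cats1 => /cat_sorted2[].
move=> n [nq rq dq]; rewrite /fill foldl_rcons -/(fill cap q).
have nq' : (n < size (rcons q e))%N by rewrite size_rcons ltnS.
rewrite /enqueue rq -drop_rcons //; case: ifP => _ /=; last first.
  exists n; split=> //; first exact: ltnW.
  by move=> x; rewrite -cats1 takel_cat //; apply: dq.
exists n.+1; split=> //.
  by rewrite -drop1 drop_drop add1n.
rewrite -nth0 nth_drop addn0 (take_nth e) // => x.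
rewrite mem_rcons in_cons => /orP[/eqP -> //|xq].
(* The edge now discarded sits at position [n]; by sortedness all those before it are no later in
   time. *)
have ss : pairwise <=%R (map snd (rcons q e)).
  by rewrite map_rcons -sorted_pairwise //; apply: le_trans.
have /(nthP e)[j] := xq; rewrite size_take nq' => jn <-.
rewrite nth_take // -!(nth_map e e.2 snd) ?(ltn_trans jn) //.
by apply: (pairwiseP e.2 ss) => //; rewrite inE size_map ?(ltn_trans jn).
Qed.

(** Discarded edges are no more recent than the last one discarded, hence outside the window. *)
Lemma recent_fill (R : realType) (L V : finType) (cap t W : R)
    (q : seq (timed_edge R L V)) :
  sorted <=%R (map snd q) -> (fill cap q).2 <= t - W ->
  recent t W (fill cap q).1 = recent t W q.
Proof.
move=> /(@fill_drop _ _ _ cap)[n [_ -> old]] dW.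
rewrite -[in RHS](cat_take_drop n q) /recent filter_cat.
rewrite (_ : filter _ (take n q) = [::]) //.
apply/eqP; rewrite -size_eq0 size_filter -leqn0 leqNgt -has_count.
apply/hasP => -[x xq]; rewrite ltNge => /negP; apply.
by apply: le_trans dW; apply: old.
Qed.

Lemma sorted_sample (R : realType) (L V : finType) (T : nat)
    (u : seq (timed_edge R L V)) (l : nat) (w : coins (size u) T) :
  sorted <=%R (map snd u) -> sorted <=%R (map snd (sample l w)).
Proof.
move=> us; apply: subseq_sorted us; first exact: le_trans.
apply: map_subseq; rewrite -[X in subseq _ X](map_tnth_enum (in_tuple u)).
by apply: map_subseq; exact: filter_subseq.
Qed.

(** When no level qualifies [find] returns [T]; the cap [T.-1] then selects the level that
    [estimate] falls back on. *)
Definition answer_level (R : realType) (L V : finType) (M T : nat) (t W : R)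
    (u : seq (timed_edge R L V)) (w : coins (size u) T) : nat :=
  minn (find (fun r => r.2 <= t - W) (run M w)) T.-1.

(** Removes the capacities from the formula: a qualifying level has lost no window edge, and the
    fallback is by definition the full sample at level [T.-1]. *)
Lemma estimateE (R : realType) (L V : finType) (g : R) (M T : nat) (t W : R)
    (u : seq (timed_edge R L V)) (w : coins (size u) T) :
  (0 < T)%N -> sorted <=%R (map snd u) ->
  estimate g M t W w
  = level_estimate g (answer_level M t W w)
      (edges_of (recent t W (sample (answer_level M t W w) w))).
Proof.
move=> T0 us; rewrite /estimate /answer /answer_level; case: ltnP => found.
  have lT := found; rewrite size_run in lT.
  rewrite (minn_idPl _); last by rewrite -ltnS prednK.
  rewrite nth_run // recent_fill ?sorted_sample // -nth_run //.
  by rewrite -has_find in found; exact: (nth_find ([::], 0) found).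
rewrite size_run in found; rewrite (minn_idPr _); last exact: leq_trans (leq_pred _) found.
congr (level_estimate _ _ (edges_of (recent _ _ _))).
rewrite /top_sample /sample; congr map; apply: eq_filter => i.
by rewrite take_oversize ?size_coins_of.
Qed.

(** Stopping-time property: below the top level, stopping at [l] is decided by the queues at levels
    [0] to [l], which read only coins below [l]. *)
Lemma eq_answer_level (R : realType) (L V : finType) (M T : nat) (t W : R)
    (u : seq (timed_edge R L V)) (l : nat) (w w' : coins (size u) T) :
  (l < T)%N ->
  {in coins_up_to T l [set: 'I_(size u)], w =1 w'} ->
  (answer_level M t W w == l) = (answer_level M t W w' == l).
Proof.
move=> lT; have T0 : (0 < T)%N by apply: leq_ltn_trans lT.
suff imp (v v' : coins (size u) T) : {in coins_up_to T l [set: 'I_(size u)], v =1 v'} ->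
    answer_level M t W v = l -> answer_level M t W v' = l.
  move=> ww'; apply/eqP/eqP; apply: imp => // c cl; exact/esym/ww'.
(* At the top level, which is also the fallback, all coins are prescribed, so the two assignments
   coincide. *)
move=> vv'; have [lE|lE] := eqVneq l T.-1.
  suff -> : v = v' by [].
  by apply/ffunP => -[i k]; apply: vv'; rewrite in_setX !inE lE /=.
have lT1 : (l < T.-1)%N by rewrite ltn_neqAle lE -ltnS prednK.
have nthE j : (j <= l)%N -> nth ([::], 0) (run M v) j = nth ([::], 0) (run M v') j.
  move=> jl; rewrite !nth_run ?(leq_ltn_trans jl) //; congr fill.
  apply: eq_sample => -[i k]; rewrite in_setX !inE /= => kj; apply: vv'.
  by rewrite in_setX !inE /= (leq_trans kj).
rewrite /answer_level; set p := fun r : reservoir R L V => _.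
move=> minE; have fE : find p (run M v) = l.
  move: minE; rewrite /minn; case: ifP => // _ e; by rewrite -e ltnn in lT1.
have pl : p (nth ([::], 0) (run M v) l).
  by rewrite -fE nth_find // has_find fE size_run.
suff -> : find p (run M v') = l by apply/minn_idPl/ltnW.
apply/eqP; rewrite eqn_leq; apply/andP; split; rewrite leqNgt; apply/negP => lt.
  by have := before_find ([::], 0) lt; rewrite -nthE // pl.
have := @before_find _ ([::], 0) p (run M v) (find p (run M v')).
rewrite fE => /(_ lt); rewrite nthE ?(ltnW lt) // nth_find //.
by rewrite has_find size_run (ltn_trans lt).
Qed.

(** * The estimate *)

Lemma coins_up_toS (m T l l' : nat) (S : {set 'I_m}) :
  (l <= l')%N -> coins_up_to T l S \subset coins_up_to T l' S.
Proof.
move=> ll'; apply/subsetP => -[i k]; rewrite !in_setX !inE /= => /andP[-> kl] /=.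
exact: leq_trans kl ll'.
Qed.

Lemma heads_split (I : finType) (D D' : {set I}) (w : {ffun I -> bool}) :
  D \subset D' -> heads D' w = heads (D' :\: D) w && heads D w.
Proof.
move=> DD'; apply/forall_inP/andP => [H|[/forall_inP H1 /forall_inP H2] i iD'].
  split; apply/forall_inP => i; first by rewrite inE => /andP[_ /H].
  by move=> /(subsetP DD') /H.
by case: (boolP (i \in D)) => [/H2 //|iD]; apply: H1; rewrite inE iD.
Qed.

(* [estimate] stops a martingale: that level [l] answers is decided by the coins
   of the levels below [l], and given these each butterfly sampled to level [l]
   reaches level [T.-1] with probability [g ^+ (4 * (T.-1 - l))]. *)
Lemma estimate_unbiased (R : realType) (L V : finType) (g : R) (M T : nat)
    (t W : R) (u : seq (timed_edge R L V)) :
  0 < g -> (0 < T)%N -> uniq (map fst u) -> sorted <=%R (map snd u) ->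
  expectation g (estimate (T := T) g M t W (u := u))
  = (num_butterflies (edges_of (recent t W u)))%:R.
Proof.
move=> g0 T0 Uu us; pose Bs := butterflies (edges_of (recent t W u)).
pose D l (B : {set L} * {set V}) := coins_up_to T l (arrivals u (setX B.1 B.2)).
pose stop := @answer_level R L V M T t W u.
have cardD l B : (l <= T.-1)%N -> B \in Bs -> #|D l B| = (4 * l)%N.
  move=> lT BB; rewrite /D card_coins_up_to // card_arrivals ?(card_butterfly BB) //.
  apply: subset_trans (butterfly_sub BB) _; apply/subsetP => e; rewrite !inE.
  by case/mapP => x; rewrite mem_filter => /andP[_ xu] ->; apply: map_f.
have stopT w : (stop w < T)%N by rewrite -[X in (_ < X)%N](prednK T0) ltnS geq_minr.
have level l : (l < T)%N -> forall B, B \in Bs ->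
    g ^- (4 * l) * bernoulli_mean g (fun w => (stop w == l)%:R * (heads (D l B) w)%:R)
    = g ^- (4 * T.-1)
      * bernoulli_mean g (fun w => (stop w == l)%:R * (heads (D T.-1 B) w)%:R).
  move=> lT B BB; have lT1 : (l <= T.-1)%N by rewrite -ltnS prednK.
  have sub : D l B \subset D T.-1 B by apply: coins_up_toS.
  (* The coins in [D T.-1 B :\: D l B] take [B] from level [l] to the top; neither stopping at [l]
     nor reaching [l] reads them. *)
  have := @bernoulli_mean_heads R g _ (D T.-1 B :\: D l B)
     (fun w => (stop w == l)%:R * (heads (D l B) w)%:R).
  rewrite cardsD (setIidPr sub) !cardD // => indep.
  rewrite [in RHS](@eq_bernoulli_mean _ _ _ _ (fun w =>
    (heads (D T.-1 B :\: D l B) w)%:R * ((stop w == l)%:R * (heads (D l B) w)%:R))); last first.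
    by move=> w; rewrite (heads_split _ sub) -mulnb natrM mulrCA.
  rewrite indep.
    rewrite mulrA; congr (_ * _).
    have e : (4 * T.-1 = (4 * T.-1 - 4 * l) + 4 * l)%N by rewrite subnK // leq_mul2l.
    have -> : g ^- (4 * T.-1) = g ^- (4 * T.-1 - 4 * l) * g ^- (4 * l).
      by rewrite -invfM -exprD -e.
    by rewrite mulrAC mulVf ?mul1r // expf_neq0 // gt_eqF.
  move=> w w' ww'; congr ((nat_of_bool _)%:R * (nat_of_bool _)%:R).
    apply: eq_answer_level => // -[i k]; rewrite in_setX in_setT inE /= => kl.
    apply: ww'; rewrite in_setC in_setD !in_setX !inE /= kl andbT; by case: (_ && (_ \in B.2)).
  have ww'D : {in D l B, w =1 w'} by move=> c cD; apply: ww'; rewrite in_setC in_setD cD.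
  exact: (eq_heads ww'D).
have -> : expectation g (estimate (T := T) g M t W (u := u))
    = bernoulli_mean g (fun w => \sum_(l < T) \sum_(B in Bs)
        g ^- (4 * l) * ((stop w == l)%:R * (heads (D l B) w)%:R)).
  apply: eq_bernoulli_mean => w; rewrite estimateE // -/(stop w).
  rewrite (bigD1 (Ordinal (stopT w))) //= [X in _ + X]big1 ?addr0 => [|l lw].
    rewrite /level_estimate num_butterflies_sample // mulr_sumr.
    by apply: eq_bigr => B _; rewrite eqxx mul1r.
  apply: big1 => B _; rewrite (_ : (stop w == l) = false) ?mul0r ?mulr0 //.
  by apply: contraNF lw => /eqP e; apply/eqP/val_inj.
rewrite bernoulli_mean_sum.
under eq_bigr => l _ do rewrite bernoulli_mean_sum.
under eq_bigr => l _ do under eq_bigr => B BB do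
  rewrite bernoulli_meanZ level ?ltn_ord //.
(* For each [B] all levels now share the factor [g ^- (4 * T.-1)]; the events [stop w == l]
   partition the space, leaving the probability [g ^+ (4 * T.-1)] that [B] reaches the top. *)
rewrite exchange_big /= /num_butterflies -sum1_card natr_sum.
apply: eq_bigr => B BB; rewrite -mulr_sumr -bernoulli_mean_sum.
rewrite (@eq_bernoulli_mean _ _ _ _ (fun w => (heads (D T.-1 B) w)%:R * 1)); last first.
  move=> w; rewrite -mulr_suml (bigD1 (Ordinal (stopT w))) //= eqxx.
  rewrite big1 ?addr0 ?mul1r ?mulr1 // => l lw.
  rewrite (_ : (stop w == l) = false) //.
  by apply: contraNF lw => /eqP e; apply/eqP/val_inj.
rewrite bernoulli_mean_heads // bernoulli_mean1 mulr1 cardD //.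
by rewrite mulVf // expf_neq0 // gt_eqF.
Qed.

(** * Tail bounds, level by level and for the estimate *)

(** Edge-disjoint butterflies read disjoint coins. By [butterfly_degree] the conflict graph has a
    greedy colouring with [4 * h] colours, whose classes are what [coloured_chernoff] asks for. *)
Lemma level_tail (R : realType) (L V : finType) (g eps : R) (T l : nat)
    (t W : R) (u : seq (timed_edge R L V)) :
  let xi := (num_butterflies (edges_of (recent t W u)))%:R : R in
  let h := max_butterflies_per_edge (edges_of u) in
  0 < g < 1 -> (l <= T.-1)%N -> uniq (map fst u) -> (0 < h)%N -> 0 < eps < 1 ->
  \sum_(w : coins (size u) T | eps * xi <=
      `|level_estimate g l (edges_of (recent t W (sample l w))) - xi|)
    coins_weight g w
  <= 2 * expR (- (eps ^+ 2 * (xi * g ^+ (4 * l)) / (8 * (4 * h)%:R))).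
Proof.
move=> xi h /andP[g0 g1] lT Uu h0 eps01.
pose Bs := butterflies (edges_of (recent t W u)).
pose D (B : {set L} * {set V}) := coins_up_to T l (arrivals u (setX B.1 B.2)).
have Wu : edges_of (recent t W u) \subset edges_of u.
  apply/subsetP => e; rewrite !inE => /mapP[x].
  by rewrite mem_filter => /andP[_ xu] ->; apply: map_f.
have cardD : {in Bs, forall B, #|D B| = (4 * l)%N}.
  move=> B BB; rewrite /D card_coins_up_to // card_arrivals ?(card_butterfly BB) //.
  exact: subset_trans (butterfly_sub BB) Wu.
pose conflict (B B' : {set L} * {set V}) := ~~ [disjoint setX B.1 B.2 & setX B'.1 B'.2].
have [] := @greedy_colouring _ conflict (4 * h)%N Bs.
- by move=> B B'; rewrite /conflict disjoint_sym.
- by rewrite muln_gt0.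
- by move=> B BB; apply: butterfly_degree.
move=> f fP.
have disjD : {in Bs &, forall B B', B != B' -> f B = f B' -> [disjoint D B & D B']}.
  move=> B B' BB B'B BB' fBB'; have : [disjoint setX B.1 B.2 & setX B'.1 B'.2].
    by apply/negPn/negP => /(fP _ _ BB B'B BB'); rewrite fBB' eqxx.
  move=> /(@disjoint_arrivals _ _ _ u) dis; apply/pred0P => -[i k] /=.
  rewrite !in_setX /=; apply/negP => /andP[/andP[iB _] /andP[iB' _]].
  by rewrite (disjointFr dis iB) in iB'.
have g01 : 0 <= g <= 1 by rewrite (ltW g0) (ltW g1).
have h4 : (0 < 4 * h)%N by rewrite muln_gt0.
apply: le_trans (coloured_chernoff g01 h4 eps01 cardD disjD).
rewrite le_eqVlt; apply/orP; left; apply/eqP; apply: eq_bigl => w.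
rewrite /level_estimate num_butterflies_sample // -/Bs -/(num_butterflies _) -/xi.
set X := \sum_(B in Bs) _.
have q0 : 0 < g ^+ (4 * l) by rewrite exprn_gt0.
have -> : g ^- (4 * l) * X - xi = g ^- (4 * l) * (X - xi * g ^+ (4 * l)).
  by field; rewrite gt_eqF.
by rewrite normrM (@gtr0_norm _ (g ^- _)) ?invr_gt0 // ler_pdivlMl // mulrCA [g ^+ _ * xi]mulrC.
Qed.

(** The answering level is random, but it is one of [T] levels, so a union bound covers it. *)
Lemma estimate_tail (R : realType) (L V : finType) (g eps : R) (M T : nat)
    (t W : R) (u : seq (timed_edge R L V)) :
  let xi := (num_butterflies (edges_of (recent t W u)))%:R : R in
  let h := max_butterflies_per_edge (edges_of u) in
  0 < g < 1 -> (0 < T)%N -> uniq (map fst u) -> sorted <=%R (map snd u) ->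
  (0 < h)%N -> 0 < eps < 1 ->
  proba g [pred w : coins (size u) T |
            eps * xi <= `|estimate g M t W w - xi|]
  <= 2 * \sum_(l < T) expR (- (eps ^+ 2 * (xi * g ^+ (4 * l)) / (8 * (4 * h)%:R))).
Proof.
move=> xi h g01 T0 Uu us h0 eps01; rewrite mulr_sumr.
pose bad l (w : coins (size u) T) := eps * xi <=
      `|level_estimate g l (edges_of (recent t W (sample l w))) - xi|.
apply: (@le_trans _ _ (\sum_(l < T) \sum_(w | bad l w) coins_weight g w)); last first.
  by apply: ler_sum => l _; apply: level_tail => //; rewrite -ltnS prednK.
under [leRHS]eq_bigr do rewrite big_mkcond.
rewrite exchange_big /= /proba big_mkcond; apply: ler_sum => w _.
have wt0 : 0 <= coins_weight g w.
  by apply: bernoulli_weight_ge0; case/andP: g01 => *; rewrite !ltW.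
have nonneg (l : 'I_T) : 0 <= (if bad l w then coins_weight g w else 0).
  by case: ifP.
rewrite inE; case: ifP => [|_]; last by apply: sumr_ge0.
rewrite estimateE //; set l0 := answer_level _ _ _ _ => badw.
have l0T : (l0 < T)%N by rewrite -[X in (_ < X)%N](prednK T0) ltnS geq_minr.
rewrite (bigD1 (Ordinal l0T)) //= {1}/bad badw lerDl.
by apply: sumr_ge0.
Qed.

(** * Summing over the levels and choosing the constants *)

Lemma Bernoulli_inequality (R : realType) (b : R) (n : nat) :
  0 <= b -> 1 + n%:R * b <= (1 + b) ^+ n.
Proof.
move=> b0; elim: n => [|n IH]; first by rewrite mul0r addr0.
rewrite exprS; apply: (@le_trans _ _ ((1 + b) * (1 + n%:R * b))); last first.
  by rewrite ler_wpM2l // addr_ge0.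
have : 0 <= n%:R * b ^+ 2 by rewrite mulr_ge0 ?sqr_ge0.
by rewrite -natr1; lra.
Qed.

Lemma half_geometric_sum_le2 (R : realType) (r : R) (n : nat) :
  0 <= r <= 1 / 2 -> \sum_(j < n) r ^+ j <= 2.
Proof.
move=> /andP[r0 r2]; elim: n => [|n IH]; first by rewrite big_ord0.
rewrite big_ord_recl /=; under eq_bigr do rewrite /bump /= add1n exprS.
by rewrite -mulr_sumr expr0; nra.
Qed.

(** Read from the top down: at [j] levels below the top the exponent is
    [x * (1 + b) ^+ j >= x + j * x * b], so a geometric series of ratio [expR (- (x * b)) <= 1 / 2]
    dominates. *)
Lemma level_tails_sum (R : realType) (g x : R) (n : nat) :
  0 < g < 1 -> 0 <= x -> 1 <= x * (g ^- 4 - 1) ->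
  \sum_(l < n.+1) expR (- (x * g ^+ (4 * l) / g ^+ (4 * n))) <= 2 * expR (- x).
Proof.
move=> /andP[g0 g1] x0 xb; set b := g ^- 4 - 1 in xb.
have g40 : 0 < g ^+ 4 by rewrite exprn_gt0.
have b0 : 0 <= b.
  by rewrite subr_ge0 invf_ge1 // exprn_ile1 // ltW.
rewrite (reindex_inj rev_ord_inj) /=.
pose r := expR (- (x * b)).
apply: (@le_trans _ _ (\sum_(j < n.+1) expR (- x) * r ^+ j)).
  apply: ler_sum => j _; rewrite /r -expRM_natl -expRD ler_expR subSS.
  have jn : (j <= n)%N by rewrite -ltnS.
  have -> : x * g ^+ (4 * (n - j)) / g ^+ (4 * n) = x * (1 + b) ^+ j.
    rewrite /b subrKC exprVn -exprM -mulrA; congr (_ * _).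
    have e : (4 * n = 4 * (n - j) + 4 * j)%N by rewrite -mulnDr subnK.
    have -> : g ^- (4 * n) = g ^- (4 * (n - j)) * g ^- (4 * j).
      by rewrite -invfM -exprD -e.
    by rewrite mulrA divff ?mul1r // expf_neq0 // gt_eqF.
  have := ler_wpM2l x0 (Bernoulli_inequality j b0); lra.
rewrite -mulr_sumr mulrC ler_wpM2r ?expR_ge0 // half_geometric_sum_le2 //.
rewrite expR_ge0 /= /r expRN div1r lef_pV2 ?posrE ?expR_gt0 //.
by apply: le_trans (expR_ge1Dx _); lra.
Qed.

(** A ceiling exceeds its argument by less than 1, so [T.-1 < 1 + lg], and [g] to the power [1 + lg]
    is [g * M / nmax]. *)
Lemma num_levels_bounds (R : realType) (g : R) (M nmax : nat) :
  0 < g < 1 -> (0 < M)%N -> M%:R < nmax%:R :> R ->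
  (0 < num_levels g M nmax)%N /\
  g * M%:R <= nmax%:R * g ^+ (num_levels g M nmax).-1.
Proof.
move=> /andP[g0 g1] M0 Mn; rewrite /num_levels.
have M0' : 0 < M%:R :> R by rewrite ltr0n.
have n0 : 0 < nmax%:R :> R by apply: lt_trans Mn.
have lng : ln g < 0 by apply: ln_lt0; rewrite g0.
set lg := logb _ _.
have lg0 : 0 < lg.
  rewrite /lg /logb -mulrNN -invrN mulr_gt0 // ?invr_gt0 oppr_gt0 //.
  by apply: ln_lt0; rewrite divr_gt0 //= ltr_pdivrMr // mul1r.
have c0 : 0 < Num.ceil (1 + lg) by rewrite ceil_gt0 addr_gt0.
have Tlt : (`|Num.ceil (1 + lg)|%N)%:R < 1 + lg + 1 :> R.
  rewrite natr_absz gtr0_norm //.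
  by have := ceilB1_lt (1 + lg); rewrite intrB ltrBlDr.
have T0 : (0 < `|Num.ceil (1 + lg)|)%N by rewrite absz_gt0 gt_eqF.
move: Tlt T0; case: `|_|%N => // k + _.
rewrite -natr1 ltrD2r /= => kl; split=> //.
have gM : g * (M%:R / nmax%:R) = expR ((1 + lg) * ln g).
  rewrite mulrDl mul1r expRD lnK // /lg /logb divfK ?lt_eqF //.
  by rewrite lnK // posrE divr_gt0.
rewrite -[g * _](divfK (lt0r_neq0 n0)) mulrC ler_wpM2l ?(ltW n0) //.
rewrite -mulrA gM -[g in leRHS](@lnK R) // -expRM_natl ler_expR.
by rewrite ler_nM2r // ltW.
Qed.

Lemma max_butterflies_gt0 (L V : finType) (G A : {set L * V}) :
  A \subset G -> (0 < num_butterflies A)%N -> (0 < max_butterflies_per_edge G)%N.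
Proof.
move=> AG /card_gt0P[B BA].
by have := leq_ltn_trans (leq0n _) (butterfly_degree AG BA); rewrite muln_gt0.
Qed.

(** Raising the hypothesis on [M] to the fourth power makes it linear in [La]. In use, [q] is
    [g ^+ T.-1], [lg] is the logarithm of [M / nmax] and [La] is [ln (h / delta)]. *)
Lemma top_level_exponent (R : realType) (g lK C D eps : R) (M nmax h : nat)
    (lg xi La q : R) :
  0 < g -> 0 < lK -> 1 <= D -> C = 32 * D / (g * lK) ->
  0 < eps -> 0 < xi -> (0 < h)%N -> 0 <= La -> (0 < nmax)%N -> lK <= lg -> 0 < q ->
  g * M%:R <= nmax%:R * q ->
  C * (lg * (nmax%:R ^+ 4 * h%:R / (eps ^+ 2 * xi) * La) `^ (4^-1)) <= M%:R ->
  D * La <= eps ^+ 2 * (xi * q ^+ 4) / (8 * (4 * h)%:R).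
Proof.
move=> g0 lK0 D1 CE e0 xi0 h0 La0 n0 lKlg q0 gM HC.
have h0' : 0 < h%:R :> R by rewrite ltr0n.
have n0' : 0 < nmax%:R :> R by rewrite ltr0n.
have s0 : 0 < eps ^+ 2 * xi by rewrite mulr_gt0 // exprn_gt0.
set P := _ * La in HC.
have P0 : 0 <= P.
  by rewrite mulr_ge0 // divr_ge0 ?(ltW s0) // mulr_ge0 ?exprn_ge0 ?(ltW h0') ?(ltW n0').
set Q := P `^ _ in HC.
have Q0 : 0 <= Q by apply: powR_ge0.
have Q4 : Q ^+ 4 = P.
  by rewrite -powR_mulrn // /Q -powRrM mulVf ?powRr1 // pnatr_eq0.
have D0 : 0 <= D by apply: le_trans D1.
(* [C] is chosen so that [g * C * lK = 32 * D]. *)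
have H1 : 32 * D * Q <= nmax%:R * q.
  apply: le_trans gM; apply: (@le_trans _ _ (g * (C * (lg * Q)))); last first.
    by rewrite ler_pM2l.
  have -> : 32 * D * Q = g * (C * (lK * Q)) by rewrite CE; field; rewrite !gt_eqF.
  rewrite ler_pM2l // ler_wpM2l ?ler_wpM2r // CE divr_ge0 ?mulr_ge0 ?(ltW g0) ?(ltW lK0) //.
have H2 : (32 * D * Q) ^+ 4 <= (nmax%:R * q) ^+ 4.
  by rewrite lerXn2r // nnegrE !mulr_ge0 // ?ler0n // ltW.
(* Of [(32 * D) ^+ 4] one factor is kept; its 32 is the [8 * 4] of the Chernoff exponent. *)
have H3 : 32 * D * P <= nmax%:R ^+ 4 * q ^+ 4.
  rewrite -exprMn; apply: le_trans H2; rewrite [leRHS]exprMn Q4 ler_wpM2r //.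
  have D32 : 1 <= 32 * D by lra.
  by rewrite -[leLHS]expr1 ler_weXn2l.
rewrite natrM ler_pdivlMr ?mulr_gt0 ?ltr0n //.
have n4 : 0 < nmax%:R ^+ 4 :> R by rewrite exprn_gt0.
have -> : D * La * (8 * (4 * h%:R)) = (32 * D * P) / nmax%:R ^+ 4 * (eps ^+ 2 * xi).
  by rewrite /P; field; rewrite !gt_eqF.
rewrite [leRHS]mulrA [leRHS]mulrC ler_wpM2r ?(ltW s0) //.
by rewrite ler_pdivrMr // [leRHS]mulrC.
Qed.

(** The summand [(g ^- 4 - 1)^-1] secures the ratio condition of [level_tails_sum]; the 3 absorbs
    its factor 2 and that of the two tails, as [4 * expR (- 3) <= 1]. *)
Lemma level_failures_le (R : realType) (g x delta : R) (T : nat) :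
  0 < g < 1 -> (0 < T)%N -> 0 < delta < 1 ->
  - ln delta + (3 + (g ^- 4 - 1)^-1) <= x ->
  2 * \sum_(l < T) expR (- (x * g ^+ (4 * l) / g ^+ (4 * T.-1))) <= delta.
Proof.
case: T => // n g01 _ /andP[d0 d1]; set b := g ^- 4 - 1 => xd.
have b0 : 0 < b.
  by case/andP: g01 => *; rewrite subr_gt0 invf_gt1 ?exprn_gt0 // exprn_ilt1 // ltW.
have bV : 0 < b^-1 by rewrite invr_gt0.
have lnd : ln delta < 0 by rewrite ln_lt0 // d0.
have x0 : 0 <= x by lra.
have xb : 1 <= x * b by rewrite -ler_pdivrMr // mul1r; lra.
have sum_le := level_tails_sum n g01 x0 xb.
have xle : expR (- x) <= delta * expR (- 3).
  by rewrite -[delta in leRHS](@lnK R) ?posrE // -expRD ler_expR; lra.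
have e3 : expR (- 3) <= 1 / 4 :> R.
  rewrite expRN div1r lef_pV2 ?posrE ?expR_gt0 //.
  by apply: le_trans (expR_ge1Dx _); lra.
have : delta * expR (- 3) <= delta * (1 / 4) by rewrite ler_pM2l.
by rewrite /=; lra.
Qed.

(** The asymptotic condition becomes a constant [C] depending only on [g], [K] and [delta0], uniform
    over streams and queries. [K] separates [nmax] from [M], keeping the logarithm above a positive
    constant; [delta0] keeps [ln (h / delta)] away from 0. *)
Theorem lemma6 (R : realType) (g K delta0 : R)
    (g_gt0 : 0 < g) (g_lt1 : g < 1) (K_gt1 : 1 < K) (delta0_lt1 : delta0 < 1) :
  exists2 C : R, 0 < C &
    forall (L V : finType) (s : seq (timed_edge R L V)) (t W : R)
           (M nmax : nat),
      graph_stream s ->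
      (0 < M)%N ->
      K * M%:R <= nmax%:R ->
      (size (window s t W) <= nmax)%N ->
      let T := num_levels g M nmax in
      let h : R := (max_butterflies_per_edge (edges_of (received s t)))%:R in
      let xi : R := (num_butterflies (edges_of (window s t W)))%:R in
      let Y := estimate (T := T) g M t W (u := received s t) in
      expectation g Y = xi
      /\
      (forall epsilon delta : R,
         0 < epsilon < 1 -> 0 < delta <= delta0 -> 0 < xi ->
         C * (logb g (M%:R / nmax%:R)
              * (nmax%:R ^+ 4 * h / (epsilon ^+ 2 * xi) * ln (h / delta))
                `^ (4^-1)) <= M%:R ->
         proba g [pred w | epsilon * xi <= `|Y w - xi|] <= delta).
Proof.
have g01 : 0 < g < 1 by rewrite g_gt0.
have lng : ln g < 0 by apply: ln_lt0.
(* [lK] is the logarithm of [1 / K] to base [g], a lower bound for that of [M / nmax]. *)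
pose lK := (- ln K) / ln g; pose b := g ^- 4 - 1.
(* [D] is such that [D * ln (h / delta)] exceeds [ln (1 / delta)] by [3 + b^-1],
   the room needed to absorb the union bound over the levels. *)
pose D := 1 + (3 + b^-1) / - ln delta0; pose C := 32 * D / (g * lK).
have lK0 : 0 < lK.
  by rewrite /lK -mulrNN -invrN opprK divr_gt0 ?ln_gt0 // oppr_gt0.
have b0 : 0 < b.
  by rewrite subr_gt0 invf_gt1 ?exprn_gt0 // exprn_ilt1 // ltW.
(* If [delta0 <= 0] no [delta] is admissible and any positive constant serves. *)
exists (if 0 < delta0 then C else 1).
  case: ifP => // d0; apply: divr_gt0; last exact: mulr_gt0.
  apply: mulr_gt0 => //.
  have : 0 < - ln delta0 by rewrite oppr_gt0 ln_lt0 // d0.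
  by move=> l0; rewrite addr_gt0 // divr_gt0 // addr_gt0 // invr_gt0.
move=> L V s t W M nmax /andP[Us ss] M0 KM _ T h xi Y.
have M0' : 0 < M%:R :> R by rewrite ltr0n.
have Mn : M%:R < nmax%:R :> R by apply: lt_le_trans KM; rewrite ltr_pMl.
have n0 : (0 < nmax)%N by rewrite -(ltr0n R); apply: lt_trans Mn.
have [T0 gM] := num_levels_bounds g01 M0 Mn.
have Uu : uniq (map fst (received s t)).
  by apply: subseq_uniq Us; apply: map_subseq; apply: filter_subseq.
have us : sorted <=%R (map snd (received s t)).
  apply: subseq_sorted ss; first exact: le_trans.
  by apply: map_subseq; apply: filter_subseq.
split; first exact: estimate_unbiased.
move=> eps delta eps01 /andP[d0 dd0] xi0.
have dd : 0 < delta0 by apply: lt_le_trans dd0.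
rewrite dd => HC.
have hN : (0 < max_butterflies_per_edge (edges_of (received s t)))%N.
  apply: (@max_butterflies_gt0 _ _ _ (edges_of (window s t W))).
    apply/subsetP => e; rewrite !inE => /mapP[x].
    by rewrite mem_filter => /andP[_ xu] ->; apply: map_f.
  by move: xi0; rewrite /xi ltr0n.
apply: le_trans (estimate_tail _ _ _ g01 T0 Uu us hN eps01) _.
rewrite -/xi; pose A l : R := eps ^+ 2 * (xi * g ^+ (4 * l)) /
  (8 * (4 * max_butterflies_per_edge (edges_of (received s t)))%:R).
set La := ln (h / delta) in HC.
have L0 : 0 < - ln delta0 by rewrite oppr_gt0 ln_lt0 // dd.
have h1 : 1 <= h by rewrite /h ler1n.
have Lad : - ln delta <= La.
  rewrite -lnV ?posrE // ler_ln ?posrE ?invr_gt0 ?divr_gt0 ?(lt_le_trans _ h1) //.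
  by rewrite ler_peMl // invr_ge0 ltW.
have LaL0 : - ln delta0 <= La.
  by apply: le_trans Lad; rewrite lerN2 ler_ln ?posrE.
have La0 : 0 < La by apply: lt_le_trans LaL0.
have D1 : 1 <= D.
  by rewrite /D lerDl divr_ge0 ?addr_ge0 ?invr_ge0 // ltW.
have DLa : La + (3 + b^-1) <= D * La.
  rewrite /D mulrDl mul1r lerD2l -mulrA ler_peMr ?addr_ge0 ?invr_ge0 ?(ltW b0) //.
  by rewrite mulrC ler_pdivlMr // mul1r.
have lKlg : lK <= logb g (M%:R / nmax%:R).
  rewrite /lK /logb ler_ndivrMr // divfK ?lt_eqF //.
  have K0 : 0 < K by apply: lt_trans K_gt1.
  rewrite -lnV ?posrE // ler_ln ?posrE ?divr_gt0 ?ltr0n ?invr_gt0 //.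
  by rewrite ler_pdivrMr ?ltr0n // ler_pdivlMl.
have q0 : 0 < g ^+ T.-1 by rewrite exprn_gt0.
have eps0 : 0 < eps by case/andP: eps01.
have AT : D * La <= A T.-1.
  rewrite /A [(4 * T.-1)%N]mulnC exprM.
  exact: (top_level_exponent g_gt0 lK0 D1 erefl eps0 xi0 hN (ltW La0) n0 lKlg q0 gM HC).
have x0 : La + (3 + b^-1) <= A T.-1 by apply: le_trans AT.
(* All exponents are expressed through the top one, the form that [level_failures_le] sums. *)
have AE l : A l = A T.-1 * g ^+ (4 * l) / g ^+ (4 * T.-1).
  have q40 : g ^+ (4 * T.-1) != 0 by rewrite expf_neq0 // gt_eqF.
  rewrite /A; set c := 8 * _.
  have c0 : c != 0 by rewrite mulf_neq0 ?pnatr_eq0 // -lt0n muln_gt0.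
  move: (g ^+ (4 * l)) (g ^+ (4 * T.-1)) c q40 c0 => a q c q40 c0.
  by field; rewrite c0 q40.
under eq_bigr do rewrite -/(A _) AE.
apply: level_failures_le => //; first by rewrite d0 (le_lt_trans dd0).
by apply: le_trans x0; rewrite lerD2r.
Qed.
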